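(* Let $\mu,\nu,\lambda\in{\sf Par}_n$ and $1\le k\le i<j\le l\le n$. Let $m=\min(i-k,l-j)$ and $M=\max(i-k,l-j)$. If $N_{\mu,\nu,\lambda}>0$, then $$\mu_i-\mu_j\le\lambda_l-\lambda_k+\nu_{m-p+1}+\nu_{M+p+2}\qquad\text{for all integers }0\le p\le m.$$
   Context: ${\sf Par}_n=\{(\lambda_1,\ldots,\lambda_n)\in{\mathbb Z}_{\ge0}^n:\lambda_1\ge\cdots\ge\lambda_n\}$. With $c_{\alpha,\beta}^{\mu}$ the Littlewood-Richardson coefficient ($s_\alpha s_\beta=\sum_\mu c_{\alpha,\beta}^\mu s_\mu$), the Newell-Littlewood number is $$N_{\mu,\nu,\lambda}=\sum_{\alpha,\beta,\gamma} c_{\alpha,\beta}^{\mu}c_{\alpha,\gamma}^{\nu}c_{\beta,\gamma}^{\lambda},$$ the sum over all triples of partitions (finitely many nonzero terms).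
   Formalization: The right-hand side has λ_k − λ_l instead of λ_l − λ_k; the printed sign fails for n=2, μ=λ=(1,0), ν=(0,0), k=i=1, j=l=2, p=0, where N=1 but the claim reads 1 ≤ −1. *)

(* Defs.v *)
From HB Require Import structures.
From mathcomp Require Import all_boot all_order all_algebra.
From mathcomp Require Import finmap mpoly.
From mathcomp Require Import boolp classical_sets fsbigop.

Set Implicit Arguments.
Unset Strict Implicit.
Unset Printing Implicit Defensive.

Import GRing.Theory.
Local Open Scope ring_scope.

Definition is_part (s : seq nat) : bool := sorted geq s && (0%N \notin s).

(* A partition is encoded by its nonzero parts only, so that partitions that
   differ by trailing zeros are identified. *)
Record partition := Partition { parts :> seq nat; partsP : is_part parts }.

HB.instance Definition _ := [isSub for parts].
HB.instance Definition _ := [Countable of partition by <:].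

Record Par (n : nat) :=
  MkPar { par_tuple :> n.-tuple nat; parP : sorted geq par_tuple }.

(* Rows are numbered from 1, with values in the integers so that differences
   are not truncated. The default value 0 is never used for 1 <= i <= n. *)
Definition part_at (n : nat) (la : Par n) (i : nat) : int :=
  Posz (nth 0%N la i.-1).

Fact part_of_subproof (n : nat) (la : Par n) :
  is_part [seq x <- par_tuple la | 0 < x]%N.
Proof.
rewrite /is_part mem_filter /= andbT sorted_filter ?parP //.
by move=> y x z /= yx zy; apply: leq_trans zy yx.
Qed.

Definition part_of (n : nat) (la : Par n) : partition :=
  Partition (part_of_subproof la).

(* The cells (row, column) of the Young diagram. *)
Definition cell (la : partition) := {i : 'I_(size la) & 'I_(nth 0%N la i)}.

Definition cell_row (la : partition) (x : cell la) : nat := tag x.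
Definition cell_col (la : partition) (x : cell la) : nat := tagged x.

Definition semistandard (N : nat) (la : partition)
    (T : {ffun cell la -> 'I_N}) : bool :=
  [forall x, forall y,
    ((cell_row x == cell_row y) && (cell_col x < cell_col y)%N
       ==> (T x <= T y)%N) &&
    ((cell_col x == cell_col y) && (cell_row x < cell_row y)%N
       ==> (T x < T y)%N)].

(* The Schur polynomial s_la(x_1, ..., x_N); it is 0 when la has more than
   N parts. *)
Definition schur (N : nat) (la : partition) : {mpoly int[N]} :=
  \sum_(T : {ffun cell la -> 'I_N} | semistandard T) \prod_x 'X_(T x).

(* An identity between symmetric functions is the family of the corresponding
   identities between symmetric polynomials, in every number N of variables. *)
Definition schur_expansion (al be : partition)
    (c : {fsfun partition -> int with 0}) : Prop :=
  forall N : nat,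
    schur N al * schur N be = \sum_(mu <- finsupp c) c mu *: schur N mu.

(* The Schur functions form a Z-basis of the ring of symmetric functions, so
   exactly one c satisfies schur_expansion al be c; the default value of xget
   is not used. *)
Definition LRcoef (al be mu : partition) : int :=
  (xget [fsfun] [set c | schur_expansion al be c]%classic :
    {fsfun partition -> int with 0}) mu.

(* fsbigop sums over the support when it is finite. It is finite here, because
   LRcoef al be mu != 0 forces |al| + |be| = |mu|. *)
Definition NLnum (mu nu la : partition) : int :=
  \sum_(t \in [set: partition * partition * partition]%classic)
    (let: (al, be, ga) := t in
     LRcoef al be mu * LRcoef al ga nu * LRcoef be ga la).

(* Main.v *)
From mathcomp Require Import all_boot all_order all_algebra.
From mathcomp Require Import all_fingroup.
From mathcomp Require Import finmap mpoly zify.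
From mathcomp Require boolp classical_sets fsbigop.
Require Import Defs.

(** A positive Newell-Littlewood number yields partitions alpha, beta, gamma
    for which the Littlewood-Richardson coefficients of mu in (alpha, beta), of
    nu in (alpha, gamma) and of la in (beta, gamma) are all nonzero. With
    a = i - k + 1 and b = l - j + 1, five inequalities between these partitions
    add up to the claim:
      mu_i <= alpha_a + beta_k,       beta_j <= mu_j,
      beta_k <= la_k,                 la_l <= beta_j + gamma_b,
      alpha_a + gamma_b <= nu_(m-p+1) + nu_(M+p+2).
    They are instances of containment ([LR_contain]), of the Weyl inequalities
    ([LR_Weyl]) and of an inequality bounding two rows at once
    ([LR_two_rows]). All three are proved for Littlewood-Richardson arrays
    ([LR_array]): for a semistandard tableau T of shape gamma they count the
    entries smaller than v in each row, T being required to have content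
    nu - alpha and to pass from alpha to nu through partitions only when its
    entries are added one by one in the reading order. In such arrays the
    inequalities are telescoping sums.

    It remains to show that a nonzero coefficient produces such an array, which
    is one half of the Littlewood-Richardson rule ([LRcoef_array]). The proof is
    Stembridge's. Since the Schur polynomial of gamma is symmetric, the
    alternant of alpha + rho times this polynomial is the sum over all
    semistandard tableaux T of the alternants of alpha + rho + weight T
    ([alternantM]). The tableaux which fail the lattice condition cancel in
    pairs: one takes the rightmost column where the condition fails and applies
    a Bender-Knuth involution to the columns on its left
    ([alternant_mul_schur]). For alpha empty a single tableau survives, which
    gives the bialternant formula ([alternant_staircase_schur]). Comparing the
    coefficients of the monomial nu + rho then identifies the
    Littlewood-Richardson coefficient with a number of lattice tableaux.

    The Bender-Knuth involution is carried out on the interlacing array of the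
    tableau, where it is a reflection of each entry of one line in the interval
    allowed by its neighbours ([toggle]); interlacing arrays and semistandard
    tableaux determine each other ([gt_tab_of], [gt_inj]). Unlike in the
    inequalities above, rows, columns and entries are numbered from 0 in the
    lemmas. *)

Set Implicit Arguments.
Unset Strict Implicit.
Unset Printing Implicit Defensive.

Import GRing.Theory Num.Theory.

Local Open Scope nat_scope.

(** * Interlacing arrays and Littlewood-Richardson arrays *)

(** Gelfand-Tsetlin patterns: [f v e] stands for the number of entries
    smaller than [v] in row [e] of a tableau. The second condition says
    that these numbers increase with [v], the third that columns are
    strict. *)
Definition interlacing (f : nat -> nat -> nat) : Prop :=
  [/\ forall e, f 0 e = 0, forall v e, f v e <= f v.+1 e
    & forall v e, f v.+1 e.+1 <= f v e].

Section Interlacing.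

Variable f : nat -> nat -> nat.
Hypothesis fI : interlacing f.

Lemma interlacing_le v w e : v <= w -> f v e <= f w e.
Proof.
case: fI => _ fS _ /subnK <-; elim: (w - v) => // d IH.
exact: leq_trans IH (fS _ _).
Qed.

Lemma interlacing_diag v e d : f (v + d) (e + d) <= f v e.
Proof.
case: fI => _ _ fD; elim: d => [|d IH]; first by rewrite !addn0.
by rewrite !addnS; apply: leq_trans (fD _ _) IH.
Qed.

Lemma interlacing_anti v e : f v e.+1 <= f v e.
Proof. by case: fI => _ fS fD; apply: leq_trans (fS _ _) (fD _ _). Qed.

Lemma interlacing_eq0 v e : v <= e -> f v e = 0.
Proof.
move=> le_ve; case: fI => f0 _ _; apply/eqP; rewrite -leqn0 -(f0 (e - v)).
by have := interlacing_diag 0 (e - v) v; rewrite add0n subnK.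
Qed.

End Interlacing.

(** The number of entries equal to [r] in the rows before row [E]. *)
Definition row_content (f : nat -> nat -> nat) r E : nat :=
  \sum_(e < E) (f r.+1 e - f r e).

(** The array [f] of a tableau of shape [ga] and content [nu - al]
    satisfying the lattice condition. [LR_lattice] is the form of this
    condition that is row by row: reading the rows from the top, each one
    from right to left, and adding a cell to row [r] of [al] for every
    entry [r] read, one has a partition at every stage. *)
Record LR_array (al ga nu : nat -> nat) (f : nat -> nat -> nat) : Prop := {
  LR_interlacing : interlacing f;
  LR_shape : exists N, forall v e, N <= v -> f v e = ga e;
  LR_weight : exists L, (forall v e, L <= e -> f v e = 0)
    /\ (forall r, nu r = al r + row_content f r L);
  LR_lattice : forall r E,
    al r.+1 + row_content f r.+1 E.+1 <= al r + row_content f r E }.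

Section LRInequalities.

Variables (al ga nu : nat -> nat) (f : nat -> nat -> nat).
Hypothesis fLR : LR_array al ga nu f.

Let A r E := al r + row_content f r E.

Let AS r E : A r E.+1 = A r E + (f r.+1 E - f r E).
Proof. by rewrite /A /row_content big_ord_recr /= addnA. Qed.

Let A0 r : A r 0 = al r.
Proof. by rewrite /A /row_content big_ord0 addn0. Qed.

Let A_lattice r E : A r.+1 E.+1 <= A r E.
Proof. exact: (LR_lattice fLR). Qed.

Let A_mono r E F : E <= F -> A r E <= A r F.
Proof.
move/subnK <-; elim: (F - E) => // d IH; apply: leq_trans IH _.
by rewrite addSn AS leq_addr.
Qed.

Let A_le_nu r E : A r E <= nu r.
Proof.
have [L [fL ->]] := LR_weight fLR; case: (leqP E L) => [|/ltnW /subnK <-].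
  exact: A_mono.
by elim: (E - L) => // d IH; rewrite addSn AS !fL ?leq_addl // addn0.
Qed.

Let nu_le_A r : exists L, forall E, L <= E -> nu r <= A r E.
Proof.
have [L [fL nuE]] := LR_weight fLR; exists L => E le_LE.
by rewrite nuE; apply: A_mono.
Qed.

Let A_diag r E d : A (r + d) (E + d) <= A r E.
Proof.
elim: d => [|d IH]; first by rewrite !addn0.
by rewrite !addnS; apply: leq_trans (A_lattice _ _) IH.
Qed.

Let f_le_ga v e : f v e <= ga e.
Proof.
have [N fN] := LR_shape fLR; rewrite -(fN (maxn N v) e) ?leq_maxl //.
by apply: (interlacing_le (LR_interlacing fLR)); rewrite leq_maxr.
Qed.

Lemma LR_contain r : al r <= nu r.
Proof. by rewrite -A0 A_le_nu. Qed.

(** The entries [a + b] in the rows from [b] on number at most [ga b], and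
    the lattice condition bounds those in the rows before [b]. *)
Lemma LR_Weyl a b : nu (a + b) <= al a + ga b.
Proof.
have [_ fS fD] := LR_interlacing fLR.
(* The numbers of entries [a + b] in the rows from [b] on telescope, as columns
   are strict. *)
have tail d : A (a + b) (b + d) + f (a + b).+1 (b + d)
              <= A (a + b) b + f (a + b).+1 b.
  elim: d => [|d IH]; first by rewrite addn0.
  rewrite addnS AS; apply: leq_trans IH.
  by have := fD (a + b) (b + d); have := fS (a + b) (b + d); lia.
have [L nuL] := nu_le_A (a + b).
have := nuL (b + L) (leq_addl _ _); have := tail L.
have := A_diag a 0 b; rewrite add0n A0; have := f_le_ga (a + b).+1 b; lia.
Qed.

(** For every [d], the entries [q], ..., [q + d] of row [b] number at most
    [A q b.+1], hence at most [nu q]: by the lattice condition, the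
    contributions of the successive entries telescope. *)
Let row_tail q b d :
  f (q + d).+1 b + A (q + d) b <= f q b + A q b.+1.
Proof.
have [_ fS _] := LR_interlacing fLR.
elim: d => [|d IH]; first by rewrite addn0 AS; have := fS q b; lia.
rewrite !addnS; apply: leq_trans IH.
have := A_lattice (q + d) b; rewrite AS; have := fS (q + d).+1 b; lia.
Qed.

(** At most [nu q] entries of row [b] are at least [q]. By strictness of
    columns, the other ones are no more than the entries at most [a] in row
    [p], which number at most [nu p - al a]. *)
Lemma LR_two_rows a b p q :
  p <= a -> p <= b -> p + q = (a + b).+1 -> al a + ga b <= nu p + nu q.
Proof.
move=> le_pa le_pb pqE.
have [N fN] := LR_shape fLR.
have ga_le : ga b <= f q b + nu q.
  have := row_tail q b N; rewrite fN; last by rewrite ltnW // ltnS leq_addl.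
  have := A_le_nu q b.+1; lia.
have al_le : al a + f a.+1 p <= nu p.
  have := row_tail p p (a - p); rewrite subnKC //.
  rewrite (interlacing_eq0 (LR_interlacing fLR) (leqnn p)).
  have := A_le_nu p p.+1; have : al a <= A a p by rewrite -A0 A_mono.
  lia.
have := interlacing_diag (LR_interlacing fLR) a.+1 p (b - p).
rewrite subnKC //; have -> : a.+1 + (b - p) = q by lia.
lia.
Qed.

End LRInequalities.

(** For [al] empty, every entry of row [e] of a lattice tableau is [e]. *)
Lemma LR_array0 ga nu f : LR_array (fun _ => 0) ga nu f ->
  forall v e, f v e = if e < v then ga e else 0.
Proof.
move=> fLR; have fI := LR_interlacing fLR; have [_ fS _] := fI.
(* The lattice condition leaves no entry [r] in the rows before row [r]. *)
have diag0 E d : row_content f (E + d) E = 0.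
  elim: E => [|E IH]; first by rewrite /row_content big_ord0.
  by have := LR_lattice fLR (E + d) E; rewrite IH addSn; lia.
have const v e : e < v -> f v.+1 e = f v e.
  move=> lt_ev; have := diag0 e.+1 (v - e.+1); rewrite subnKC //.
  by rewrite /row_content big_ord_recr /=; have := fS v e; lia.
move=> v e; case: ltnP => [lt_ev|/(interlacing_eq0 fI) //].
have [N fN] := LR_shape fLR; rewrite -(fN (v + N) e) ?leq_addl //.
elim: N {fN} => [|d IH]; first by rewrite addn0.
by rewrite addnS const // (leq_trans lt_ev) // leq_addr.
Qed.

(** * Bender-Knuth toggles of interlacing arrays *)

Section Toggle.

Variable f : nat -> nat -> nat.

(** With line [r.+1] forgotten, its entry in row [e] can be chosen freely
    between [toggle_lo r e] and [toggle_hi r e]. *)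
Definition toggle_lo r e : nat := maxn (f r e) (f r.+2 e.+1).

Definition toggle_hi r e : nat :=
  if e is e'.+1 then minn (f r.+2 e) (f r e') else f r.+2 0.

(** The Bender-Knuth involution exchanging the numbers of entries [r] and
    [r.+1] in the columns before [c]: in each row, [f r.+1 e] is reflected
    in the interval of its possible values, truncated at [c]. *)
Definition toggle (r c v e : nat) : nat :=
  if (v == r.+1) && (toggle_lo r e <= c)
  then toggle_lo r e + minn (toggle_hi r e) c - f v e else f v e.

(** Column [c] contains no entry [r]; the columns before [c] can then be
    modified as above without violating the row condition at column [c]. *)
Definition cut_ok r c : Prop := forall e, f r.+1 e <= c \/ c < f r e.

Lemma toggle_other r c v e : v != r.+1 -> toggle r c v e = f v e.
Proof. by rewrite /toggle => /negPf ->. Qed.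

Hypothesis fI : interlacing f.

Lemma toggle_lo_le r e : toggle_lo r e <= f r.+1 e.
Proof. by case: fI => _ fS fD; rewrite geq_max fS fD. Qed.

Lemma toggle_hi_ge r e : f r.+1 e <= toggle_hi r e.
Proof.
by case: fI => _ fS fD; case: e => [|e] /=; rewrite ?leq_min ?fS ?fD.
Qed.

Variables r c : nat.
Hypothesis fc : cut_ok r c.

Lemma cut_ok_le e : toggle_lo r e <= c -> f r.+1 e <= c.
Proof. by rewrite geq_max => /andP[le_fc _]; case: (fc e) => //; lia. Qed.

Lemma toggle_bounds e :
  toggle_lo r e <= toggle r c r.+1 e <= toggle_hi r e.
Proof.
rewrite /toggle eqxx /=; have := toggle_lo_le r e; have := toggle_hi_ge r e.
by case: (leqP (toggle_lo r e) c) => [/cut_ok_le|]; lia.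
Qed.

Lemma toggle_interlacing : interlacing (toggle r c).
Proof.
have [f0 fS fD] := fI; split=> [e|v e|v e].
- by rewrite toggle_other.
- case: (eqVneq v r.+1) => [->|ne_v].
    rewrite [leqRHS]toggle_other; last by lia.
    have /andP[_ /leq_trans-> //] := toggle_bounds e.
    by case: e => [|e] //=; rewrite geq_minl.
  rewrite toggle_other //; case: (eqVneq v r) => [->|ne_vr].
    by have /andP[+ _] := toggle_bounds e; rewrite geq_max => /andP[].
  by rewrite toggle_other ?fS // eqSS.
- case: (eqVneq v r.+1) => [->|ne_v].
    rewrite [leqLHS]toggle_other; last by lia.
    by have /andP[+ _] := toggle_bounds e; rewrite geq_max => /andP[].
  rewrite [leqRHS]toggle_other //; case: (eqVneq v r) => [->|ne_vr].
    have /andP[_ /leq_trans-> //] := toggle_bounds e.+1.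
    by rewrite /= geq_minr.
  by rewrite toggle_other ?fD // eqSS.
Qed.

Lemma toggle_sub c' v e : c <= c' -> toggle r c v e - c' = f v e - c'.
Proof.
move=> le_cc'; rewrite /toggle; case: eqP => //= ->.
have := toggle_lo_le r e.
by case: (leqP (toggle_lo r e) c) => // /[dup] /cut_ok_le; lia.
Qed.

Lemma toggle_min e :
  minn (toggle r c r.+1 e) c + minn (f r.+1 e) c =
  minn (toggle_lo r e) c + minn (toggle_hi r e) c.
Proof.
have := toggle_lo_le r e; have := toggle_hi_ge r e.
rewrite /toggle eqxx /=.
by case: (leqP (toggle_lo r e) c) => [/[dup] /cut_ok_le|]; lia.
Qed.

(** The upper bound in row [e.+1] and the lower bound in row [e] are the
    minimum and the maximum of the same two numbers. *)
Lemma sum_toggle_bounds L : (forall v e, L <= e -> f v e = 0) ->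
  \sum_(e < L.+1) (minn (toggle_lo r e) c + minn (toggle_hi r e) c) =
  \sum_(e < L.+1) (minn (f r e) c + minn (f r.+2 e) c).
Proof.
move=> fL.
(* Pairing the upper bound of each row with the lower bound of the previous one
   leaves over the lower bound of the last row. *)
have main M :
  \sum_(e < M.+1) (minn (toggle_lo r e) c + minn (toggle_hi r e) c)
    + minn (f r M) c
  = \sum_(e < M.+1) (minn (f r e) c + minn (f r.+2 e) c)
    + minn (toggle_lo r M) c.
  elim: M => [|M IH]; first by rewrite !big_ord_recr !big_ord0 /=; lia.
  rewrite big_ord_recr [in RHS]big_ord_recr /=.
  have : minn (toggle_lo r M) c + minn (toggle_hi r M.+1) c
         = minn (f r M) c + minn (f r.+2 M.+1) c.
    by rewrite /toggle_lo /=; lia.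
  by move: IH => /=; lia.
have := main L; have -> : toggle_lo r L = 0 by rewrite /toggle_lo !fL.
by rewrite fL // min0n !addn0.
Qed.

Lemma sum_toggle_min L : (forall v e, L <= e -> f v e = 0) ->
  \sum_(e < L.+1) minn (toggle r c r.+1 e) c + \sum_(e < L.+1) minn (f r.+1 e) c
  = \sum_(e < L.+1) minn (f r e) c + \sum_(e < L.+1) minn (f r.+2 e) c.
Proof.
move=> fL; rewrite -!big_split /= -sum_toggle_bounds //.
by apply: eq_bigr => e _; rewrite toggle_min.
Qed.

End Toggle.

Lemma toggle_bounds_toggle f r c e :
  (toggle_lo (toggle f r c) r e = toggle_lo f r e) *
  (toggle_hi (toggle f r c) r e = toggle_hi f r e).
Proof.
have E1 e' : toggle f r c r e' = f r e' by rewrite toggle_other //; lia.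
have E2 e' : toggle f r c r.+2 e' = f r.+2 e' by rewrite toggle_other //; lia.
by rewrite /toggle_lo /toggle_hi; case: e => [|e]; rewrite !(E1, E2).
Qed.

Lemma toggle_cut_ok f r c :
  interlacing f -> cut_ok f r c -> cut_ok (toggle f r c) r c.
Proof.
move=> fI fc e; rewrite [toggle f r c r e]toggle_other; last by lia.
rewrite /toggle eqxx /=; have := toggle_lo_le fI r e.
case: (leqP (toggle_lo f r e) c) => [/[dup] /(cut_ok_le fc)|]; first by lia.
by case: (fc e); lia.
Qed.

Lemma toggleK f (r c v e : nat) : interlacing f -> cut_ok f r c ->
  toggle (toggle f r c) r c v e = f v e.
Proof.
move=> fI fc; rewrite {1}/toggle !toggle_bounds_toggle.
have := toggle_lo_le fI r e; have := toggle_hi_ge fI r e.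
rewrite /toggle; case: (eqVneq v r.+1) => //= ->.
by case: (leqP (toggle_lo f r e) c) => // /[dup] /(cut_ok_le fc); lia.
Qed.

(** * Contents of an array to the right of a column *)

(** The number of entries [r] in the columns from [c] on, counted in the
    first [L] rows. *)
Definition col_content (f : nat -> nat -> nat) L c r : nat :=
  \sum_(e < L) ((f r.+1 e - c) - (f r e - c)).

Section ColContent.

Variables (f : nat -> nat -> nat) (L : nat).
Hypothesis fI : interlacing f.

Lemma col_contentS c r :
  col_content f L c r =
  col_content f L c.+1 r + \sum_(e < L) (f r e <= c < f r.+1 e).
Proof.
rewrite /col_content -big_split /=; apply: eq_bigr => e _.
by have [_ fS _] := fI; have := fS r e; lia.
Qed.

(** An entry occurs at most once in a column. *)
Lemma col_mult_le1 c r : \sum_(e < L) (f r e <= c < f r.+1 e) <= 1.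
Proof.
case: L => [|M]; first by rewrite big_ord0.
apply: (@leq_trans (f r M <= c)); last exact: leq_b1.
elim: M => [|M IH]; first by rewrite big_ord_recr big_ord0 /=; lia.
rewrite big_ord_recr /=.
have [_ _ fD] := fI; have := fD r M; have := interlacing_anti fI r M.
by move: IH => /=; lia.
Qed.

Lemma row_content_split c r :
  row_content f r L + \sum_(e < L) minn (f r e) c
  = \sum_(e < L) minn (f r.+1 e) c + col_content f L c r.
Proof.
rewrite /row_content /col_content -!big_split /=; apply: eq_bigr => e _.
by have [_ fS _] := fI; have := fS r e; lia.
Qed.

End ColContent.

Section ToggleContent.

Variables (f : nat -> nat -> nat) (r c L : nat).
Hypotheses (fI : interlacing f) (fc : cut_ok f r c).
Hypothesis fL : forall v e, L <= e -> f v e = 0.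

Let f' := toggle f r c.

Lemma toggle_col_content c' v M :
  c <= c' -> col_content f' M c' v = col_content f M c' v.
Proof.
by move=> le_c; apply: eq_bigr => e _; rewrite /f' !toggle_sub.
Qed.

(** Adding entries in the columns before [c] to those in the columns from
    [c] on, this lemma and the next say that the toggle exchanges the
    numbers of entries [r] and [r.+1] before column [c]. *)
Lemma toggle_content_l :
  row_content f' r L.+1 + col_content f L.+1 c r.+1
  = row_content f r.+1 L.+1 + col_content f L.+1 c r.
Proof.
have f'I : interlacing f' by apply: toggle_interlacing.
have := row_content_split L.+1 f'I c r.
have := row_content_split L.+1 fI c r.+1.
have := sum_toggle_min fI fc fL; rewrite toggle_col_content // -/f'.
have -> : \sum_(e < L.+1) minn (f' r e) c = \sum_(e < L.+1) minn (f r e) c.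
  by apply: eq_bigr => e _; rewrite /f' toggle_other //; lia.
lia.
Qed.

Lemma toggle_content_r :
  row_content f' r.+1 L.+1 + col_content f L.+1 c r
  = row_content f r L.+1 + col_content f L.+1 c r.+1.
Proof.
have f'I : interlacing f' by apply: toggle_interlacing.
have := row_content_split L.+1 f'I c r.+1.
have := row_content_split L.+1 fI c r.
have := sum_toggle_min fI fc fL; rewrite toggle_col_content // -/f'.
have -> : \sum_(e < L.+1) minn (f' r.+2 e) c
          = \sum_(e < L.+1) minn (f r.+2 e) c.
  by apply: eq_bigr => e _; rewrite /f' toggle_other //; lia.
lia.
Qed.

Lemma toggle_content_other v M :
  v != r -> v != r.+1 -> row_content f' v M = row_content f v M.
Proof.
by move=> ? ?; apply: eq_bigr => e _; rewrite /f' !toggle_other ?eqSS.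
Qed.

End ToggleContent.

(** Adding to [al] the contents of the columns from [c] on does not give a
    partition: row [r.+1] becomes longer than row [r]. *)
Definition breaks (al : nat -> nat) (f : nat -> nat -> nat) L c r : bool :=
  al r + col_content f L c r < al r.+1 + col_content f L c r.+1.

Section Breaks.

Variables (al : nat -> nat) (f : nat -> nat -> nat) (L : nat).
Hypothesis al_anti : forall r, al r.+1 <= al r.
Hypothesis fI : interlacing f.

(** At the rightmost column where the lattice condition fails it fails by
    1, and this column contains [r.+1] but not [r]. *)
Lemma breaks_last c r : breaks al f L c r -> ~~ breaks al f L c.+1 r ->
  al r.+1 + col_content f L c r.+1 = (al r + col_content f L c r).+1
  /\ forall e, e < L -> f r.+1 e <= c \/ c < f r e.
Proof.
rewrite /breaks -leqNgt (col_contentS L fI c r) (col_contentS L fI c r.+1).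
have := col_mult_le1 L fI c r.+1.
set h := (X in _ -> _ < _ + (_ + X) -> _).
set h0 := \sum_(e < L) (f r e <= c < f r.+1 e).
move=> le_h lt_al le_al; split; first by lia.
move=> e lt_e; have : h0 == 0 by lia.
rewrite sum_nat_eq0 => /forallP/(_ (Ordinal lt_e)) /=; lia.
Qed.

Lemma breaks_bounded c r : (forall v e, f v e <= c) -> ~~ breaks al f L c r.
Proof.
move=> le_c; rewrite /breaks -leqNgt.
have cc0 v : col_content f L c v = 0.
  by rewrite /col_content big1 // => e _; have := le_c v.+1 e; lia.
by rewrite !cc0 !addn0.
Qed.

(** The lattice condition read by columns implies the one read by rows: the
    entries [r.+1] of rows up to [E] lie in the columns from [f r.+1 E] on,
    and the entries [r] of these columns lie in the rows before [E]. *)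
Lemma no_break_lattice r E :
  (forall v e, L <= e -> f v e = 0) -> (forall c, ~~ breaks al f L c r) ->
  al r.+1 + row_content f r.+1 E.+1 <= al r + row_content f r E.
Proof.
move=> fL ok; have [_ fS fD] := fI.
case: (ltnP E L) => [lt_EL|le_LE].
  have := ok (f r.+1 E); rewrite /breaks -leqNgt.
  set c := f r.+1 E => le_c.
  (* In rows up to [E], the entries [r.+1] are in the columns from [c] on. *)
  have le1 : row_content f r.+1 E.+1 <= col_content f L c r.+1.
    rewrite /row_content.
    rewrite (big_ord_widen _ (fun e => f r.+2 e - f r.+1 e) lt_EL).
    rewrite big_mkcond /=; apply: leq_sum => e _; case: ltnP => // lt_eE.
    have : c <= f r.+1 e.
      rewrite /c -(subnKC (ltnSE lt_eE)); elim: (E - e) => [|d IH].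
        by rewrite addn0.
      by rewrite addnS (leq_trans (interlacing_anti fI _ _)).
    by lia.
  (* From row [E] on, no entry [r] is in the columns from [c] on. *)
  have le2 : col_content f L c r <= row_content f r E.
    rewrite /row_content.
    rewrite (big_ord_widen _ (fun e => f r.+1 e - f r e) (ltnW lt_EL)).
    rewrite [leqRHS]big_mkcond /=; apply: leq_sum => e _.
    case: ltnP => [|le_Ee].
      by have := fS r e; lia.
    have : f r.+1 e <= c.
      rewrite /c -(subnKC le_Ee); elim: (e - E) => [|d IH].
        by rewrite addn0.
      by rewrite addnS (leq_trans (interlacing_anti fI _ _)).
    by lia.
  lia.
have row_L v M : L <= M -> row_content f v M = row_content f v L.
  move/subnKC <-; elim: (M - L) => [|d IH]; first by rewrite addn0.
  by rewrite addnS /row_content big_ord_recr /= -/(row_content f v _) IH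
    !fL ?leq_addr // addn0.
have := ok 0; rewrite /breaks -leqNgt.
have cc0 v : col_content f L 0 v = row_content f v L.
  by apply: eq_bigr => e _; rewrite !subn0.
by rewrite !cc0 !row_L // leqW.
Qed.

End Breaks.

(** * Semistandard tableaux as interlacing arrays *)

Section Cells.

Variable la : partition.

(** The length of row [e], for all [e]. *)
Definition row_len (e : nat) : nat := nth 0 la e.

Lemma row_len_default e : size la <= e -> row_len e = 0.
Proof. exact: nth_default. Qed.

Lemma row_len_anti e d : e <= d -> row_len d <= row_len e.
Proof.
move=> le_ed; have /andP[la_s _] := partsP la.
case: (ltnP d (size la)) => [lt_d|]; last by move/row_len_default->.
have geT : transitive geq by move=> y x z /= yx zy; apply: leq_trans zy yx.
apply: (sorted_leq_nth geT (fun x => leqnn x) 0 la_s) => //.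
by rewrite inE (leq_ltn_trans le_ed).
Qed.

Lemma cell_row_lt (x : cell la) : cell_row x < size la.
Proof. exact: ltn_ord. Qed.

Lemma cell_col_lt (x : cell la) : cell_col x < row_len (cell_row x).
Proof. exact: ltn_ord. Qed.

Lemma cellP (e c : nat) :
  c < row_len e -> {x : cell la | cell_row x = e & cell_col x = c}.
Proof.
move=> lt_c; case: (ltnP e (size la)) => [lt_e|/row_len_default pe]; last first.
  by rewrite pe in lt_c.
by exists (Tagged (fun i : 'I_(size la) => 'I_(nth 0 la i))
  (Ordinal lt_c : 'I_(nth 0 la (Ordinal lt_e)))).
Qed.

Lemma cell_inj (x y : cell la) :
  cell_row x = cell_row y -> cell_col x = cell_col y -> x = y.
Proof.
case: x y => [i c] [i' c']; rewrite /cell_row /cell_col /= => /val_inj eq_i.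
by case: i' / eq_i c' => c' /val_inj ->.
Qed.

Lemma card_row_prefix e k : k <= row_len e ->
  #|[pred x : cell la | (cell_row x == e) && (cell_col x < k)]| = k.
Proof.
move=> le_k.
pose h (c : 'I_k) := s2val (cellP (leq_trans (ltn_ord c) le_k)).
have h_row c : cell_row (h c) = e by rewrite /h; case: cellP.
have h_col c : cell_col (h c) = c by rewrite /h; case: cellP.
have h_inj : injective h.
  by move=> c d eq_h; apply/val_inj; rewrite /= -!h_col eq_h.
rewrite -[RHS]card_ord -(card_codom h_inj); apply: eq_card => x.
rewrite !inE; apply/andP/codomP => [[/eqP row_x col_x]|[c ->]].
  by exists (Ordinal col_x); apply: cell_inj; rewrite ?h_row ?h_col.
by rewrite h_row h_col eqxx ltn_ord.
Qed.

End Cells.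

Section Tableaux.

Variables (N : nat) (la : partition).

Local Notation tableau := {ffun cell la -> 'I_N}.
Implicit Types (T : tableau) (x y : cell la).

(** The interlacing array of a tableau. *)
Definition gt_array T (v e : nat) : nat :=
  #|[pred x : cell la | (cell_row x == e) && (T x < v)]|.

Lemma semistandardP T : reflect
  ((forall x y, cell_row x = cell_row y -> cell_col x < cell_col y ->
      T x <= T y) /\
   (forall x y, cell_col x = cell_col y -> cell_row x < cell_row y ->
      T x < T y))
  (semistandard T).
Proof.
apply: (iffP forallP) => [ssT|[Tr Tc] x].
  split=> x y eq_xy lt_xy; move/forallP/(_ y)/andP: (ssT x) => [].
    by move=> /implyP-> //; rewrite eq_xy eqxx.
  by move=> _ /implyP-> //; rewrite eq_xy eqxx.
apply/forallP=> y; apply/andP; split; apply/implyP => /andP[/eqP + lt_xy].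
  by move/Tr; apply.
by move/Tc; apply.
Qed.

Lemma gt_le_row_len T v e : gt_array T v e <= row_len la e.
Proof.
rewrite -[leqRHS](card_row_prefix (leqnn (row_len la e))).
apply: subset_leq_card; apply/subsetP => x; rewrite !inE.
by move=> /andP[/eqP <- _]; rewrite eqxx cell_col_lt.
Qed.

Lemma gt_shape T v e : N <= v -> gt_array T v e = row_len la e.
Proof.
move=> le_Nv; rewrite -[RHS](card_row_prefix (leqnn (row_len la e))).
apply: eq_card => x; rewrite !inE (leq_trans (ltn_ord _) le_Nv) andbT.
by case: eqP => //= <-; rewrite cell_col_lt.
Qed.

Lemma gt_default T v e : size la <= e -> gt_array T v e = 0.
Proof.
by move=> /row_len_default la_e; apply/eqP; rewrite -leqn0 -la_e gt_le_row_len.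
Qed.

(** The entries smaller than [v] fill an initial segment of each row. *)
Lemma gt_arrayP T x v : semistandard T ->
  (T x < v) = (cell_col x < gt_array T v (cell_row x)).
Proof.
move=> /semistandardP[Tr _]; have lt_x := cell_col_lt x.
case: (ltnP (T x) v) => [lt_v|le_v]; apply/esym.
  rewrite -{1}(card_row_prefix lt_x); apply: subset_leq_card.
  apply/subsetP => y; rewrite !inE ltnS leq_eqVlt.
  case/andP=> /eqP row_y /orP[/eqP col_y|col_y].
    by rewrite (cell_inj row_y col_y) eqxx.
  by rewrite row_y eqxx (leq_ltn_trans (Tr _ _ row_y col_y)).
apply/negbTE; rewrite -leqNgt.
rewrite -[leqRHS](card_row_prefix (ltnW lt_x)); apply: subset_leq_card.
apply/subsetP => y; rewrite !inE => /andP[/eqP row_y lt_y].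
rewrite row_y eqxx /= ltnNge leq_eqVlt; apply/negP => /orP[/eqP|] col_y.
  by move: lt_y; rewrite -(cell_inj (esym row_y) col_y) ltnNge le_v.
have := Tr _ _ (esym row_y) col_y; lia.
Qed.

Lemma gt_interlacing T : semistandard T -> interlacing (gt_array T).
Proof.
move=> ssT; split=> [e|v e|v e].
- by apply: eq_card0 => x; rewrite !inE ltn0 andbF.
- apply: subset_leq_card; apply/subsetP => x; rewrite !inE.
  by case/andP=> -> /ltnW.
rewrite leqNgt; apply/negP => lt_gt.
have lt_S : gt_array T v e < row_len la e.+1.
  exact: leq_trans lt_gt (gt_le_row_len _ _ _).
have [y row_y col_y] := cellP lt_S.
have [x row_x col_x] := cellP (leq_trans lt_S (row_len_anti la (leqnSn e))).
have [_ /(_ x y)] := semistandardP _ ssT.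
rewrite row_x row_y col_x col_y leqnn => /(_ erefl isT).
have := gt_arrayP x v ssT; rewrite row_x col_x ltnn => /negbT.
have := gt_arrayP y v.+1 ssT; rewrite row_y col_y lt_gt.
lia.
Qed.

Lemma gt_inj T T' : semistandard T -> semistandard T' ->
  (forall v e, gt_array T v e = gt_array T' v e) -> T = T'.
Proof.
move=> ssT ssT' eq_gt; apply/ffunP => x; apply/val_inj/eqP.
have lt_iff v : (T x < v) = (T' x < v) by rewrite !gt_arrayP // eq_gt.
rewrite eqn_leq -[_ <= T' x]ltnS -[_ <= T x]ltnS lt_iff ltnS leqnn /=.
by rewrite -lt_iff ltnS leqnn.
Qed.

Lemma sum_gt T v L : size la <= L ->
  \sum_(e < L) gt_array T v e = #|[pred x | T x < v]|.
Proof.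
move=> le_L; rewrite -sum1_card.
pose h (x : cell la) : 'I_L := Ordinal (leq_trans (cell_row_lt x) le_L).
rewrite (partition_big h xpredT) //=; apply: eq_bigr => e _.
rewrite /gt_array -sum1_card; apply: eq_bigl => x.
by rewrite !inE andbC -val_eqE.
Qed.

(** The content of a tableau: how many times it contains each entry. *)
Definition weight T : 'X_{1..N} := [multinom #|[pred x | T x == i]| | i < N].

Lemma prod_weight T : (\prod_x 'X_(T x) = 'X_[weight T] :> {mpoly int[N]})%R.
Proof.
rewrite -(big_morph _ (@mpolyXD N int) (mpolyX0 N int)).
congr mpolyX; apply/mnmP => i.
rewrite mnm_sumE mnmE -sum1_card [RHS]big_mkcond /=.
by apply: eq_bigr => x _; rewrite mnm1E inE; case: eqP.
Qed.

Lemma weightE T L (i : 'I_N) : semistandard T -> size la <= L ->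
  weight T i = row_content (gt_array T) i L.
Proof.
move=> ssT le_L; rewrite mnmE /row_content.
have [_ gtS _] := gt_interlacing ssT.
apply: (@addIn (\sum_(e < L) gt_array T i e)); rewrite -big_split /=.
under [RHS]eq_bigr do rewrite subnK ?gtS //.
rewrite !sum_gt // -cardUI [X in _ + X]eq_card0; last first.
  by move=> x; rewrite !inE -val_eqE /=; case: ltngtP.
rewrite addn0; apply: eq_card => x.
by rewrite !inE ltnS -val_eqE /= -leq_eqVlt.
Qed.

End Tableaux.

Section TableauOfArray.

Variables (N : nat) (la : partition) (f : nat -> nat -> nat).

(** The tableau with interlacing array [f]: its entry in column [c] of row
    [e] is the smallest [v] with [c < f v.+1 e]. The search is limited to
    [v < N], as the line [N.+1] of the array contains the lengths of the
    rows. *)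
Definition tab_of : {ffun cell la -> 'I_N.+1} :=
  [ffun x => inord
    (find (fun v => cell_col x < f v.+1 (cell_row x)) (iota 0 N))].

Hypothesis fI : interlacing f.
Hypothesis fN : forall v e, N < v -> f v e = row_len la e.

Lemma tab_of_lt (x : cell la) v :
  (tab_of x < v) = (cell_col x < f v (cell_row x)).
Proof.
rewrite ffunE inordK; last first.
  by rewrite ltnS (leq_trans (find_size _ _)) ?size_iota.
set p := fun v => _; set s := iota 0 N.
case: v => [|w]; first by case: fI => ->.
rewrite ltnS; case: (ltnP w N) => [lt_wN|le_Nw]; last first.
  rewrite fN // cell_col_lt (leq_trans _ le_Nw) //.
  by rewrite -[leqRHS](size_iota 0 N) find_size.
apply/idP/idP => [le_w|pw].
  have lt_N : find p s < N by rewrite (leq_ltn_trans le_w).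
  have : has p s by rewrite has_find size_iota.
  move/(nth_find 0); rewrite nth_iota // add0n => /leq_trans-> //.
  exact: interlacing_le.
rewrite leqNgt; apply/negP => /(before_find 0).
by rewrite nth_iota // add0n /p pw.
Qed.

Lemma tab_of_semistandard : semistandard tab_of.
Proof.
apply/semistandardP; split=> x y eq_xy lt_xy.
  rewrite -ltnS tab_of_lt eq_xy (ltn_trans lt_xy) //.
  by rewrite -tab_of_lt.
rewrite tab_of_lt eq_xy.
have : cell_col y < f (tab_of y).+1 (cell_row y) by rewrite -tab_of_lt.
move=> /leq_trans-> //; rewrite -(subnKC lt_xy) addSnnS.
apply: leq_trans (interlacing_le fI _ _) (interlacing_diag fI _ _ _).
by rewrite addnS ltnS leq_addr.
Qed.

Lemma gt_tab_of v e : gt_array tab_of v e = f v e.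
Proof.
have f_le : f v e <= row_len la e.
  by rewrite -(fN e (leq_addl v N.+1)) interlacing_le // leq_addr.
rewrite -[RHS](card_row_prefix f_le); apply: eq_card => x.
by rewrite !inE tab_of_lt; case: eqP => // ->.
Qed.

End TableauOfArray.

(** * Alternants *)

Section Alternants.

Variable N : nat.
Local Open Scope ring_scope.
Implicit Types (m : 'X_{1..N}) (p : {mpoly int[N]}) (s w : 'S_N).

(** The exponents of [m], permuted by [s]. *)
Definition mnm_perm m s : 'X_{1..N} := [multinom m (s i) | i < N].

(** The antisymmetrization of the monomial with exponents [m]. *)
Definition alternant m : {mpoly int[N]} :=
  \sum_(w : 'S_N) (-1) ^+ w *: msym w 'X_[m].

Lemma alternant_perm m s : alternant (mnm_perm m s) = (-1) ^+ s *: alternant m.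
Proof.
rewrite /alternant scaler_sumr (reindex_inj (mulgI s)) /=.
apply: eq_bigr => w _; rewrite odd_permM signr_addb scalerA msymMm msymX.
congr (_ *: msym w 'X_[_]); apply/mnmP => i.
by rewrite !mnmE permKV.
Qed.

Lemma alternantM m p : p \is symmetric ->
  alternant m * p = \sum_(w : 'S_N) (-1) ^+ w *: msym w ('X_[m] * p).
Proof.
move=> /issymP p_sym; rewrite mulr_suml; apply: eq_bigr => w _.
by rewrite msymM p_sym -scalerAl.
Qed.

Definition strictly_decreasing m : Prop :=
  forall i j : 'I_N, (i < j)%N -> (m j < m i)%N.

(** A permutation relating two strictly decreasing sequences is increasing,
    so that it moves no index down. *)
Lemma strict_perm_ge m m' s (i : 'I_N) :
  strictly_decreasing m -> strictly_decreasing m' -> mnm_perm m s = m' ->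
  (i <= s i)%N.
Proof.
move=> m_dec m'_dec ms; have s_inc (j k : 'I_N) : (j < k)%N -> (s j < s k)%N.
  move=> lt_jk; have := m'_dec _ _ lt_jk; rewrite -ms !mnmE.
  case: (ltngtP (s j) (s k)) => // [/m_dec|/val_inj ->]; last by rewrite ltnn.
  by lia.
elim: {i}(val i) {-2}i (erefl (val i)) => [|d IH] i id.
  by move: id => /= ->.
have lt_d : (d < N)%N by move: id (ltn_ord i) => /=; lia.
have := s_inc (Ordinal lt_d) i; have := IH (Ordinal lt_d) erefl.
rewrite /= id; move: id => /=; lia.
Qed.

Lemma mcoeff_alternant m m' :
  strictly_decreasing m -> strictly_decreasing m' ->
  (alternant m)@_m' = (m == m')%:R.
Proof.
move=> m_dec m'_dec.
have perm_id s : mnm_perm m s = m' -> s = 1%g.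
  move=> ms; apply/permP => i; rewrite perm1; apply/val_inj/eqP.
  rewrite eqn_leq (strict_perm_ge _ m_dec m'_dec ms) andbT /=.
  have := @strict_perm_ge m' m s^-1 (s i) m'_dec m_dec; rewrite permK; apply.
  by rewrite -ms; apply/mnmP => j; rewrite !mnmE permKV.
rewrite /alternant raddf_sum (bigD1 1%g) //= big1 => [|w ne_w].
  by rewrite odd_perm1 expr0 scale1r msym1m mcoeffX addr0.
rewrite mcoeffZ msymX mcoeffX; case: eqP => [ms|]; last by rewrite mulr0.
by case/eqP: ne_w; rewrite -[w]invgK (perm_id _ ms) invg1.
Qed.

Lemma adjacent_symmetric p :
  (forall i j : 'I_N, j = i.+1 :> nat -> msym (tperm i j) p = p) ->
  p \is symmetric.
Proof.
move=> p_adj.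
have p_tperm d (i j : 'I_N) : j = (i + d)%N :> nat -> msym (tperm i j) p = p.
  elim: d i j => [|d IH] i j ij.
    have -> : j = i by apply: val_inj; rewrite /= ij addn0.
    by rewrite tperm1 msym1m.
  have lt_k : (i + d < N)%N by apply: leq_ltn_trans (ltn_ord j); lia.
  pose k := Ordinal lt_k.
  have kj : msym (tperm k j) p = p by apply: p_adj; rewrite ij addnS.
  have [ik|ne_ik] := eqVneq i k; first by rewrite ik.
  have -> : tperm i j = (tperm i k ^ tperm k j)%g.
    rewrite tpermJ tpermL tpermD // 1?eq_sym //.
    by apply/eqP => /(congr1 val) /=; lia.
  by rewrite conjgE tpermV !msymMm kj IH.
apply/issymP => s; have [ts -> _] := prod_tpermP s.
elim: ts => [|[i j] ts IH]; first by rewrite big_nil msym1m.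
rewrite big_cons msymMm /=; have -> // : msym (tperm i j) p = p.
case: (leqP i j) => [/subnKC/esym/p_tperm //|/ltnW/subnKC/esym].
by rewrite tpermC => /p_tperm.
Qed.

End Alternants.

(** * Bender-Knuth involutions on tableaux and symmetry of Schur polynomials *)

Section ToggleTableau.

Variables (n : nat) (la : partition).
Local Notation L := (size la).+1.
Local Notation tableau := {ffun cell la -> 'I_n.+1}.
Implicit Type T : tableau.

(** The Bender-Knuth involution of entries [r] and [r.+1] in the columns
    before [c], on tableaux. *)
Definition toggle_tab T (r c : nat) : tableau :=
  tab_of n la (toggle (gt_array T) r c).

Variables (T : tableau) (r : 'I_n) (c : nat).
Hypotheses (ssT : semistandard T) (Tc : cut_ok (gt_array T) r c).

Let toggle_shape v e : n < v -> toggle (gt_array T) r c v e = row_len la e.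
Proof.
move=> lt_nv; rewrite toggle_other ?gt_shape //.
by have := ltn_ord r; lia.
Qed.

Lemma toggle_tab_semistandard : semistandard (toggle_tab T r c).
Proof.
apply: tab_of_semistandard toggle_shape.
exact: (toggle_interlacing (gt_interlacing ssT) Tc).
Qed.

Lemma gt_toggle_tab : gt_array (toggle_tab T r c) = toggle (gt_array T) r c.
Proof.
apply: boolp.funext => v; apply: boolp.funext => e.
apply: gt_tab_of toggle_shape _ _.
exact: (toggle_interlacing (gt_interlacing ssT) Tc).
Qed.

Let i : 'I_n.+1 := widen_ord (leqnSn n) r.
Let j : 'I_n.+1 := lift ord0 r.

(** When the columns from [c] on balance the exponents of [a] in positions
    [r] and [r.+1], toggling transposes the exponents of [a + weight T]. *)
Lemma toggle_weight (a : 'X_{1..n.+1}) :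
  a i + col_content (gt_array T) L c r
    = a j + col_content (gt_array T) L c r.+1 ->
  (a + weight (toggle_tab T r c))%MM = mnm_perm (a + weight T)%MM (tperm i j).
Proof.
move=> eq_a; have gI := gt_interlacing ssT.
have ssT' := toggle_tab_semistandard.
have le_L : size la <= L by [].
have gL v e : size la <= e -> gt_array T v e = 0 by apply: gt_default.
have jE : j = r.+1 :> nat by [].
apply/mnmP => k; rewrite [RHS]mnmE !mnmDE !(weightE _ _ le_L) // gt_toggle_tab.
have [->|ne_ki] := eqVneq k i.
  rewrite tpermL jE /=; have := toggle_content_l gI Tc gL; lia.
have [->|ne_kj] := eqVneq k j.
  rewrite tpermR jE /=; have := toggle_content_r gI Tc gL; lia.
rewrite tpermD 1?eq_sym // toggle_content_other //.
Qed.

End ToggleTableau.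

Lemma toggle_tabK n la (T : {ffun cell la -> 'I_n.+1}) (r : 'I_n) c :
  semistandard T -> cut_ok (gt_array T) r c ->
  toggle_tab (toggle_tab T r c) r c = T.
Proof.
move=> ssT Tc; have gI := gt_interlacing ssT.
have ssT' := toggle_tab_semistandard ssT Tc.
have Tc' : cut_ok (gt_array (toggle_tab T r c)) r c.
  by rewrite gt_toggle_tab //; apply: toggle_cut_ok.
apply: gt_inj => //; first exact: toggle_tab_semistandard.
by move=> v e; rewrite gt_toggle_tab // gt_toggle_tab //; exact: toggleK.
Qed.

Lemma schurE n la : (schur n.+1 la =
  \sum_(T : {ffun cell la -> 'I_n.+1} | semistandard T) 'X_[weight T])%R.
Proof. by apply: eq_bigr => T _; rewrite prod_weight. Qed.

Lemma schur_symmetric n la : schur n.+1 la \is symmetric.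
Proof.
apply: adjacent_symmetric => i j ij; rewrite schurE raddf_sum /=.
have lt_r : i < n by have := ltn_ord j; lia.
pose r := Ordinal lt_r; pose c := row_len la 0.
have le_c (T : {ffun cell la -> 'I_n.+1}) v e : gt_array T v e <= c.
  exact: leq_trans (gt_le_row_len _ _ _) (row_len_anti _ (leq0n e)).
have Tc (T : {ffun cell la -> 'I_n.+1}) : cut_ok (gt_array T) r c by left.
have cc0 (T : {ffun cell la -> 'I_n.+1}) v L :
    col_content (gt_array T) L c v = 0.
  by apply: big1 => e _; have := le_c T v.+1 e; lia.
(* Column [c] is beyond the first row, so that all columns are toggled. *)
rewrite [RHS](reindex_onto (fun T => toggle_tab T r c)
  (fun T => toggle_tab T r c)) => [|T ssT]; last exact: toggle_tabK.
apply: eq_big => [T|T ssT].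
  apply/idP/andP => [ssT|[ssT' /eqP <-]].
    by rewrite toggle_tab_semistandard // toggle_tabK.
  exact: toggle_tab_semistandard.
have := toggle_weight ssT (Tc T) (a := 0%MM); rewrite !mnm0E !cc0.
move=> /(_ erefl); rewrite !add0m msymX => ->.
have -> : widen_ord (leqnSn n) r = i by apply: val_inj.
have -> : lift ord0 r = j by apply: val_inj; rewrite /= ij.
by rewrite tpermV; congr mpolyX; apply/mnmP => k; rewrite !mnmE.
Qed.

(** * Cancellation in the product of an alternant and a Schur polynomial *)

(** The first [n.+1] rows of [al], as exponents. *)
Definition mnm_of n (al : nat -> nat) : 'X_{1..n.+1} :=
  [multinom al i | i < n.+1].

(** The vector usually called rho. *)
Definition staircase n : 'X_{1..n.+1} := mnm_of n (fun i => n - i).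

Section Cancellation.

Variables (n : nat) (la : partition) (al : nat -> nat).
Hypothesis al_anti : forall r, al r.+1 <= al r.
Local Notation L := (size la).+1.
Local Notation tableau := {ffun cell la -> 'I_n.+1}.
Local Notation position := ('I_(row_len la 0).+1 * 'I_n)%type.
Implicit Type T : tableau.

(** The lattice condition, read by columns: no column breaks it. Columns
    beyond the first row and entries beyond [n] never do, so finitely many
    pairs of a column and an entry are tested. *)
Definition LR_tableau T : bool :=
  [forall p : position, ~~ breaks al (gt_array T) L p.1 p.2].

(** The pair [p] of a column and an entry witnesses the failure of the
    lattice condition in the rightmost column where it fails. *)
Definition last_break T (p : position) : bool :=
  breaks al (gt_array T) L p.1 p.2 &&
  [forall q : position, (p.1 < q.1) ==> ~~ breaks al (gt_array T) L q.1 q.2].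

(** The involution pairing the tableaux which fail the lattice condition:
    it toggles a chosen pair of entries to the left of the last break. *)
Definition flip T : tableau :=
  if [pick p | last_break T p] is Some p then toggle_tab T p.2 p.1 else T.

Lemma le_part0 T v e : gt_array T v e <= row_len la 0.
Proof. exact: leq_trans (gt_le_row_len _ _ _) (row_len_anti _ (leq0n e)). Qed.

Lemma LR_tableau_no_break T c (r : 'I_n) :
  LR_tableau T -> ~~ breaks al (gt_array T) L c r.
Proof.
move=> /forallP goodT; case: (ltnP c (row_len la 0).+1) => [lt_c|/ltnW le_c].
  exact: (goodT (Ordinal lt_c, r)).
by apply: breaks_bounded => // v e; apply: leq_trans (le_part0 T v e) le_c.
Qed.

Lemma last_break_exists T : ~~ LR_tableau T -> exists p, last_break T p.
Proof.
move=> /forallPn[p0]; rewrite negbK => p0T.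
pose P (p : position) := breaks al (gt_array T) L p.1 p.2.
case: (@arg_maxnP _ p0 P (fun p => p.1) p0T) => p pT p_max; exists p.
rewrite /last_break; apply/andP; split=> //.
apply/forallP => q; apply/implyP => lt_pq; apply/negP => /p_max.
by rewrite /= leqNgt lt_pq.
Qed.

Lemma last_break_tight T p : semistandard T -> last_break T p ->
  al p.2.+1 + col_content (gt_array T) L p.1 p.2.+1
    = (al p.2 + col_content (gt_array T) L p.1 p.2).+1
  /\ cut_ok (gt_array T) p.2 p.1.
Proof.
move=> ssT /andP[pT /forallP p_last]; have gI := gt_interlacing ssT.
have lt_p : p.1.+1 < (row_len la 0).+1.
  rewrite ltnS ltnNge; apply/negP => le_p; move: pT; apply/negP.
  by apply: breaks_bounded => // v e; apply: leq_trans (le_part0 T v e) le_p.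
have := p_last (Ordinal lt_p, p.2); rewrite /= ltnSn /= => nbreak.
have [eq_p cutp] := breaks_last gI pT nbreak; split=> // e.
case: (ltnP e L) => [|/ltnW le_e]; first exact: cutp.
by left; rewrite gt_default.
Qed.

(** Toggling changes nothing in the columns from the last break on, so that
    [flip] makes the same choice for the toggled tableau. *)
Lemma last_break_toggle T p : semistandard T -> last_break T p ->
  last_break (toggle_tab T p.2 p.1) =1 last_break T.
Proof.
move=> ssT pT; have [_ cutp] := last_break_tight ssT pT.
have gI := gt_interlacing ssT.
pose T' := toggle_tab T p.2 p.1.
have same (q : position) : p.1 <= q.1 ->
    breaks al (gt_array T') L q.1 q.2 = breaks al (gt_array T) L q.1 q.2.
  by move=> le_pq; rewrite /breaks /T' gt_toggle_tab // !toggle_col_content.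
have breakp : breaks al (gt_array T) L p.1 p.2 by case/andP: pT.
move=> q; rewrite /last_break -/T'; case: (leqP p.1 q.1) => [le_pq|lt_qp].
  rewrite same //; congr (_ && _); apply: eq_forallb => q'.
  case: ltnP => //= lt_qq'; rewrite same // (leq_trans le_pq) //.
  exact: ltnW.
apply/andP/andP => -[_ /forallP/(_ p)]; rewrite lt_qp /=.
  by rewrite same // breakp.
by rewrite breakp.
Qed.

Lemma flipP T : semistandard T -> ~~ LR_tableau T ->
  exists2 p, last_break T p & [pick q | last_break T q] = Some p.
Proof.
move=> ssT /last_break_exists[p0 p0T].
by case: pickP => [p pT|/(_ p0)]; [exists p | rewrite p0T].
Qed.

Lemma flip_bad T : semistandard T -> ~~ LR_tableau T ->
  semistandard (flip T) && ~~ LR_tableau (flip T).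
Proof.
move=> ssT badT; have [p pT pickT] := flipP ssT badT.
have [_ cutp] := last_break_tight ssT pT.
rewrite /flip pickT toggle_tab_semistandard //=.
apply/forallPn; exists p; rewrite negbK.
by have := pT; rewrite -(last_break_toggle ssT pT) => /andP[].
Qed.

Lemma flipK T : semistandard T -> ~~ LR_tableau T -> flip (flip T) = T.
Proof.
move=> ssT badT; have [p pT pickT] := flipP ssT badT.
have [_ cutp] := last_break_tight ssT pT.
have flipT : flip T = toggle_tab T p.2 p.1 by rewrite /flip pickT.
rewrite flipT /flip (eq_pick (last_break_toggle ssT pT)) pickT.
exact: toggle_tabK.
Qed.

Let shifted : 'X_{1..n.+1} := (mnm_of n al + staircase n)%MM.

Lemma alternant_flip T : semistandard T -> ~~ LR_tableau T ->
  (alternant (shifted + weight (flip T))%MM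
   = - alternant (shifted + weight T)%MM)%R.
Proof.
move=> ssT badT; have [p pT pickT] := flipP ssT badT.
have [tight cutp] := last_break_tight ssT pT.
rewrite /flip pickT (toggle_weight ssT cutp); last first.
  rewrite /shifted !mnmDE !mnmE /=; move: tight.
  have -> : bump 0 p.2 = p.2.+1 by [].
  by have := ltn_ord p.2; lia.
rewrite alternant_perm odd_tperm.
have -> : widen_ord (leqnSn n) p.2 != lift ord0 p.2.
  by rewrite -val_eqE /= /bump /=; lia.
by rewrite expr1 scaleN1r.
Qed.

(** The tableaux failing the lattice condition contribute a sum equal to
    its own opposite. *)
Lemma alternant_mul_schur :
  (alternant shifted * schur n.+1 la =
   \sum_(T : tableau | semistandard T && LR_tableau T)
     alternant (shifted + weight T)%MM)%R.
Proof.
rewrite alternantM ?schur_symmetric // schurE.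
transitivity (\sum_(T : tableau | semistandard T)
                 alternant (shifted + weight T)%MM)%R.
  rewrite [RHS]exchange_big /=; apply: eq_bigr => w _.
  rewrite mulr_sumr [msym _ _]raddf_sum scaler_sumr /=; apply: eq_bigr => T _.
  by rewrite mpolyXD.
rewrite (bigID LR_tableau) /= [X in (_ + X)%R](_ : _ = 0%R) ?addr0 //.
set S := (\sum_(T | _) _)%R.
(* [flip] preserves the index set of [S] and changes the sign of each term. *)
have SN : S = (- S)%R.
  rewrite {1}/S (reindex_onto flip flip) => [|T /andP[]]; last exact: flipK.
  rewrite /S -sumrN; apply: eq_big => [T|T].
    apply/idP/idP => [/andP[/andP[ss' bad'] /eqP <-]|/andP[ssT badT]].
      exact: flip_bad.
    by rewrite flip_bad // flipK ?eqxx.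
  case/andP=> /andP[ss' bad'] /eqP flipT; apply: alternant_flip.
    by rewrite -flipT; have /andP[] := flip_bad ss' bad'.
  by rewrite -flipT; have /andP[] := flip_bad ss' bad'.
apply/mpolyP => m; have := congr1 (mcoeff m) SN; rewrite mcoeffN mcoeff0; lia.
Qed.

Lemma LR_tableau_decreasing T : semistandard T -> LR_tableau T ->
  strictly_decreasing (shifted + weight T)%MM.
Proof.
move=> ssT goodT i j lt_ij.
pose g r := al r + row_content (gt_array T) r L.
have g_anti d : i + d <= n -> g (i + d) <= g i.
  elim: d => [|d IH] le_n; first by rewrite addn0.
  have lt_r : i + d < n by rewrite -addnS.
  apply: leq_trans (IH (ltnW lt_r)); rewrite addnS.
  have := LR_tableau_no_break 0 (Ordinal lt_r) goodT.
  have cc0 v : col_content (gt_array T) L 0 v = row_content (gt_array T) v L.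
    by apply: eq_bigr => e _; rewrite !subn0.
  by rewrite /breaks /= !cc0 -leqNgt.
have := g_anti (j - i); rewrite subnKC ?(ltnW lt_ij) // => /(_ (ltn_ord j)).
rewrite /g /shifted !mnmDE !(weightE _ ssT (leqnSn _)) !mnmE /=.
by have := ltn_ord j; lia.
Qed.

Lemma LR_tableau_array (nu : nat -> nat) T :
  semistandard T -> LR_tableau T ->
  (forall i, n < i -> al i = 0) -> (forall i, n < i -> nu i = 0) ->
  (shifted + weight T = mnm_of n nu + staircase n)%MM ->
  LR_array al (row_len la) nu (gt_array T).
Proof.
move=> ssT goodT al_n nu_n nuE; have gI := gt_interlacing ssT.
have gL v e : L <= e -> gt_array T v e = 0 by move=> /ltnW; apply: gt_default.
have row0 r M : n < r -> row_content (gt_array T) r M = 0.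
  move=> lt_r; apply: big1 => e _; rewrite !gt_shape ?subnn //; lia.
split=> //.
- by exists n.+1 => v e; apply: gt_shape.
- exists L; split=> // r; case: (ltnP r n.+1) => [lt_r|le_r].
    have := congr1 (fun m : 'X_{1..n.+1} => m (Ordinal lt_r)) nuE.
    rewrite /shifted /= !mnmDE (weightE _ ssT (leqnSn _)) !mnmE /=; lia.
  by rewrite nu_n // al_n // row0.
- move=> r E; case: (ltnP r n) => [lt_r|le_r].
    apply: no_break_lattice gL _ => // c.
    exact: (LR_tableau_no_break c (Ordinal lt_r) goodT).
  by rewrite row0 ?addn0 //; apply: leq_trans (al_anti r) (leq_addr _ _).
Qed.

End Cancellation.

(** * Littlewood-Richardson coefficients and arrays *)

Section Bialternant.

Variables (n : nat) (la : partition).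
Hypothesis size_la : size la <= n.+1.
Local Notation L := (size la).+1.

(** The array of the tableau in which every entry of row [e] is [e]. *)
Let ground (v e : nat) : nat := if e < v then row_len la e else 0.

Let ground_interlacing : interlacing ground.
Proof.
have la_anti := row_len_anti la; split=> [e|v e|v e]; rewrite /ground //.
  by case: ltnP => // lt_ev; rewrite leqW.
by rewrite ltnS; case: ltnP => // _; apply: la_anti.
Qed.

Let ground_shape v e : n < v -> ground v e = row_len la e.
Proof.
move=> lt_nv; rewrite /ground; case: ltnP => // le_ve.
by rewrite row_len_default // (leq_trans size_la) // (leq_trans lt_nv).
Qed.

Let T0 := tab_of n la ground.

Let T0_semistandard : semistandard T0.
Proof. exact: tab_of_semistandard. Qed.

Let gt_T0 : gt_array T0 = ground.
Proof.
by apply: boolp.funext => v; apply: boolp.funext => e; apply: gt_tab_of.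
Qed.

Let ground_content c r : col_content ground L c r = row_len la r - c.
Proof.
case: (ltnP r L) => [lt_r|le_r].
  rewrite /col_content (bigD1 (Ordinal lt_r)) //= big1 => [|e ne_e].
    by rewrite /ground ltnSn ltnn; lia.
  have : e != r :> nat by rewrite -val_eqE in ne_e.
  by rewrite /ground ltnS; case: (ltngtP e r) => //; lia.
rewrite (row_len_default (ltnW le_r)) /col_content big1 // => e _.
rewrite /ground.
have ne_e : e != r :> nat by have := ltn_ord e; lia.
by rewrite ltnS; case: (ltngtP e r) ne_e => //; lia.
Qed.

Let T0_LR : LR_tableau (fun _ => 0) T0.
Proof.
apply/forallP => p; rewrite /breaks gt_T0 !ground_content !add0n -leqNgt.
by apply: leq_sub2r; apply: row_len_anti.
Qed.

Let T0_weight : weight T0 = mnm_of n (row_len la).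
Proof.
apply/mnmP => i; rewrite (weightE i T0_semistandard (leqnSn _)) mnmE gt_T0.
rewrite -[RHS]subn0 -ground_content.
by apply: eq_bigr => e _; rewrite !subn0.
Qed.

(** The bialternant formula for Schur polynomials. *)
Lemma alternant_staircase_schur :
  (alternant (staircase n) * schur n.+1 la =
   alternant (mnm_of n (row_len la) + staircase n)%MM)%R.
Proof.
pose z (_ : nat) := 0.
have shift0 : (mnm_of n z + staircase n)%MM = staircase n.
  by apply/mnmP => i; rewrite mnmDE !mnmE.
have anti0 r : z r.+1 <= z r by [].
rewrite -{1}shift0 alternant_mul_schur // shift0 (bigD1 T0) /=; last first.
  by rewrite T0_semistandard T0_LR.
rewrite big1 ?addr0 => [|T /andP[/andP[ssT goodT] /eqP ne_T]].
  by rewrite T0_weight addmC.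
case: ne_T; apply: gt_inj => // v e; rewrite gt_T0.
pose nu i := if i < n.+1 then weight T (inord i) else 0.
have T_LR : LR_array (fun _ => 0) (row_len la) nu (gt_array T).
  apply: (@LR_tableau_array n) => // [i lt_i|].
    by rewrite /nu ltnNge lt_i.
  rewrite shift0 addmC; congr (_ + _)%MM; apply/mnmP => i.
  by rewrite [RHS]mnmE /nu ltn_ord inord_val.
exact: (LR_array0 T_LR).
Qed.

End Bialternant.

Lemma shifted_part_decreasing n la :
  strictly_decreasing (mnm_of n (row_len la) + staircase n)%MM.
Proof.
move=> i j lt_ij; rewrite !mnmDE !mnmE /=.
by have := row_len_anti la (ltnW lt_ij); have := ltn_ord j; lia.
Qed.

Lemma row_len_gt0 (la : partition) i : (0 < row_len la i) = (i < size la).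
Proof.
case: (ltnP i (size la)) => [lt_i|/row_len_default -> //].
have /andP[_ la_0] := partsP la; rewrite lt0n.
by apply: contra la_0 => /eqP <-; rewrite mem_nth.
Qed.

Lemma mnm_of_part_inj n (la mu : partition) :
  size la <= n.+1 -> size mu <= n.+1 ->
  mnm_of n (row_len la) = mnm_of n (row_len mu) -> la = mu.
Proof.
move=> la_n mu_n eq_lm.
have eq_part i : row_len la i = row_len mu i.
  case: (ltnP i n.+1) => [lt_i|le_i]; last first.
    by rewrite !row_len_default ?(leq_trans _ le_i).
  have := congr1 (fun m : 'X_{1..n.+1} => m (Ordinal lt_i)) eq_lm.
  by rewrite !mnmE.
have lt_size i : (i < size la) = (i < size mu) by rewrite -!row_len_gt0 eq_part.
have eq_size : size la = size mu.
  by have := lt_size (size la); have := lt_size (size mu); lia.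
by apply: val_inj; apply: (@eq_from_nth _ 0) => // i _; apply: eq_part.
Qed.

Lemma sorted_geq_nth (s : seq nat) r :
  sorted geq s -> nth 0 [seq x <- s | 0 < x] r = nth 0 s r.
Proof.
elim: s r => [|x s IH] r //= sx.
have ss : sorted geq s by apply: path_sorted sx.
case: ltnP => [_|]; first by case: r => [|r] //=; apply: IH.
rewrite leqn0 => /eqP x0; move: sx; rewrite x0 IH // => sx.
have s0 q : nth 0 s q = 0.
  case: (ltnP q (size s)) => [lt_q|]; last exact: nth_default.
  have geT : transitive geq by move=> b a d /= ab db; apply: leq_trans db ab.
  have /allP/(_ _ (mem_nth 0 lt_q)) := order_path_min geT sx.
  by rewrite /= leqn0 => /eqP.
by case: r => [|r] /=; rewrite !s0.
Qed.

Lemma nth_part_of n (la : Par n) r : row_len (part_of la) r = nth 0 la r.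
Proof. exact: sorted_geq_nth (parP la). Qed.

Lemma LRcoefC al be mu : LRcoef al be mu = LRcoef be al mu.
Proof.
suff expE : schur_expansion al be = schur_expansion be al.
  by rewrite /LRcoef expE.
apply: boolp.funext => c; apply: boolp.propext.
by split=> c_exp N; rewrite mulrC.
Qed.

(** A nonzero coefficient cannot come from the default value, so that an
    expansion exists. *)
Lemma LRcoef_expansion al be mu : LRcoef al be mu <> 0%R ->
  exists2 c : {fsfun partition -> int with 0%R},
    schur_expansion al be c & c mu <> 0%R.
Proof.
rewrite /LRcoef; case: classical_sets.xgetP => [c _ c_exp c_mu|_].
  by exists c.
by rewrite fsfun0E.
Qed.

(** The number [n.+1] of variables is chosen so large that no partition in
    sight has more rows; the Schur polynomials involved are then
    independent. *)
Theorem LRcoef_array (al ga nu : partition) : LRcoef al ga nu <> 0%R ->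
  exists f, LR_array (row_len al) (row_len ga) (row_len nu) f.
Proof.
move=> /LRcoef_expansion[c c_exp c_nu].
pose n := (size al + size ga + size nu + \max_(mu <- finsupp c) size mu)%N.
have size_c mu : mu \in finsupp c -> size mu <= n.+1.
  move=> mu_c; apply: leqW; apply: leq_trans (leq_addl _ _).
  by apply: (leq_bigmax_seq mu (F := fun ka : partition => size ka)).
have al_anti r : row_len al r.+1 <= row_len al r by apply: row_len_anti.
have nu_c : nu \in finsupp c by rewrite mem_finsupp; apply/eqP.
pose sh mu := (mnm_of n (row_len mu) + staircase n)%MM.
(* Both sides are the alternant of rho times the Schur polynomials of [al] and
   [ga]. *)
have expand : (\sum_(T : {ffun cell ga -> 'I_n.+1} |
                 semistandard T && LR_tableau (row_len al) T)
                 alternant (sh al + weight T)%MM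
  = \sum_(mu <- finsupp c) c mu *: alternant (sh mu))%R.
  rewrite -alternant_mul_schur // -alternant_staircase_schur; last first.
    by rewrite /n; lia.
  rewrite -mulrA c_exp mulr_sumr; apply: eq_big_seq => mu mu_c.
  by rewrite -scalerAr alternant_staircase_schur // size_c.
have coef_r :
  ((\sum_(mu <- finsupp c) c mu *: alternant (sh mu))@_(sh nu) = c nu)%R.
  rewrite raddf_sum (bigD1_seq nu) ?fset_uniq //= mcoeffZ.
  rewrite mcoeff_alternant ?eqxx ?mulr1; [|exact: shifted_part_decreasing..].
  rewrite big1_seq ?addr0 // => mu /andP[ne_mu mu_c].
  rewrite mcoeffZ mcoeff_alternant; [|exact: shifted_part_decreasing..].
  case: eqP => [eq_sh|]; last by rewrite mulr0.
  case/eqP: ne_mu; apply: (@mnm_of_part_inj n); rewrite ?size_c //.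
  exact: (addIm eq_sh).
have [T /andP[ssT goodT] /eqP coefT] : exists2 T : {ffun cell ga -> 'I_n.+1},
    semistandard T && LR_tableau (row_len al) T &
    ((alternant (sh al + weight T)%MM)@_(sh nu) != 0)%R.
  apply/exists_inP; apply: contra_notT c_nu => /exists_inPn all0.
  rewrite -coef_r -expand raddf_sum big1 // => T goodT.
  by apply/eqP; have := all0 T goodT; rewrite negbK.
exists (gt_array T); apply: (@LR_tableau_array n) => //.
- by move=> i lt_i; rewrite row_len_default //; move: lt_i; rewrite /n; lia.
- by move=> i lt_i; rewrite row_len_default //; move: lt_i; rewrite /n; lia.
move: coefT; rewrite mcoeff_alternant; first by case: eqP.
- exact: LR_tableau_decreasing.
- exact: shifted_part_decreasing.
Qed.

(** * The inequality for Newell-Littlewood numbers *)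

Unset Implicit Arguments.
Local Close Scope nat_scope.
Local Open Scope ring_scope.

(* The source prints the difference of rows of lambda as lambda_l - lambda_k.
   That is a sign slip: for n = 2, mu = lambda = (1,0), nu = (0,0) and
   k = i = 1, j = l = 2, p = 0 it would assert 1 <= -1 although N = 1.
   The intended term is lambda_k - lambda_l. *)
Theorem theorem5p12 (n : nat) (mu nu la : Par n) (k i j l : nat)
    (hk : (1 <= k)%N) (hki : (k <= i)%N) (hij : (i < j)%N) (hjl : (j <= l)%N)
    (hln : (l <= n)%N)
    (hN : 0 < NLnum (part_of mu) (part_of nu) (part_of la)) :
  let m := minn (i - k) (l - j) in
  let M := maxn (i - k) (l - j) in
  forall p : nat, (p <= m)%N ->
    part_at mu i - part_at mu j
      <= part_at la k - part_at la l + part_at nu (m - p + 1)%N + part_at nu (M + p + 2)%N.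
Proof.
move=> m M p le_pm.
have part_atE (ka : Par n) r : part_at ka r = row_len (part_of ka) r.-1.
  by rewrite /part_at -nth_part_of.
(* A sum all of whose terms vanish is not positive. *)
have [[[al be] ga] /eqP t_neq0] : exists t : partition * partition * partition,
    (let: (al, be, ga) := t in
     LRcoef al be (part_of mu) * LRcoef al ga (part_of nu)
       * LRcoef be ga (part_of la) != 0)%R.
  apply: boolp.contrapT => all0; move: hN.
  rewrite /NLnum fsbigop.fsbig1 ?ltxx //.
  move=> [[al be] ga] _; apply: boolp.contrapT => /eqP t_neq0.
  by apply: all0; exists (al, be, ga).
have /LRcoef_array[f f_LR] : LRcoef al be (part_of mu) <> 0%R.
  by move=> c0; apply: t_neq0; rewrite c0 !mul0r.
have /LRcoef_array[f' f'_LR] : LRcoef be al (part_of mu) <> 0%R.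
  by rewrite LRcoefC => c0; apply: t_neq0; rewrite c0 !mul0r.
have /LRcoef_array[g g_LR] : LRcoef al ga (part_of nu) <> 0%R.
  by move=> c0; apply: t_neq0; rewrite c0 mulr0 mul0r.
have /LRcoef_array[h h_LR] : LRcoef be ga (part_of la) <> 0%R.
  by move=> c0; apply: t_neq0; rewrite c0 mulr0.
have mu_i := LR_Weyl f_LR (i - k) k.-1.
have mu_j := LR_contain f'_LR j.-1.
have la_k := LR_contain h_LR k.-1.
have la_l := LR_Weyl h_LR j.-1 (l - j).
have mM : (m + M = i - k + (l - j))%N by rewrite addn_min_max.
have m_ik : (m <= i - k)%N by apply: geq_minl.
have m_lj : (m <= l - j)%N by apply: geq_minr.
have nu_pq : (row_len al (i - k) + row_len ga (l - j)
    <= row_len (part_of nu) (m - p) + row_len (part_of nu) (M + p).+1)%N.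
  by apply: (LR_two_rows g_LR); lia.
rewrite !part_atE addn1 addn2 /=.
have -> : (i.-1 = i - k + k.-1)%N by lia.
have -> : (l.-1 = j.-1 + (l - j))%N by lia.
lia.
Qed.
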